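(* Let $\mathcal X$ be a proper metric space satisfying the shrinking assumption (A) given in the context. Let $\mu\in\mathcal P(\mathcal X\times\{0,1\})$ be a probability measure and $\varrho_i:=\mu(\,\cdot\,\times\{i\})$ for $i\in\{0,1\}$. For all $u\in C_b(\mathcal X)$, $\mathbf m\in\mathfrak M$ and $i\in\{0,1\}$, $$\int_{\mathcal X}\int_{\mathcal X}\mathrm{grad}_\varepsilon[u](x,y)\,\mathrm dm_x(y)\,\mathrm d\varrho_i(x)=-\int_{\mathcal X}u\,\mathrm d\,\mathrm{div}_\varepsilon^{\varrho_i}[\mathbf m].$$ Moreover, for all $u\in C_b(\mathcal X)$, $$\mathrm{TV}_\varepsilon(u)=\max_{\underline{\mathbf m}\in\mathfrak M\times\mathfrak M}-\int_{\mathcal X}u(x)\,\mathrm d\,\mathrm{div}^{\boldsymbol\varrho}_\varepsilon[\underline{\mathbf m}](x).$$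
   Context: Fix $\varepsilon>0$. A metric space $(\mathcal X,\mathrm d)$ is proper if every closed and bounded subset is compact; $\overline{\mathrm B}_r(x)=\{y\in\mathcal X:\mathrm d(x,y)\le r\}$; $C_b(\mathcal X)$ is the space of bounded continuous functions. Assumption (A): for every $x\in\mathcal X$ and $0<r<\varepsilon$ there is a measurable map $T_{x,r}:\overline{\mathrm B}_\varepsilon(x)\to\overline{\mathrm B}_{\varepsilon-r}(x)$ with $\mathrm d(T_{x,r}(y),y)\le r$ for all $y\in\overline{\mathrm B}_\varepsilon(x)$. Put $\varrho:=\varrho_0+\varrho_1$, $\boldsymbol\varrho=(\varrho_0,\varrho_1)$, and $$\mathrm{TV}_\varepsilon(u)=\int_{\mathcal X}\frac{\max_{\overline{\mathrm B}_\varepsilon(x)}u-u(x)}{\varepsilon}\,\mathrm d\varrho_0(x)+\int_{\mathcal X}\frac{u(x)-\min_{\overline{\mathrm B}_\varepsilon(x)}u}{\varepsilon}\,\mathrm d\varrho_1(x).$$ A random walk $\mathbf m\in RW(\mathcal X)$ is a family $(m_x)_{x\in\mathcal X}$ of Borel probability measures on $\mathcal X$ such that (i) for all Borel $A\subset\mathcal X$ and Borel $B\subset\mathbb R$ the set $\{x:m_x(A)\in B\}$ is Borel; (ii) for some $x_0\in\mathcal X$ and all $x\in\mathcal X$, $\int_{\mathcal X}\mathrm d(x_0,y)\,\mathrm dm_x(y)<\infty$. Set $\mathfrak M:=\{\mathbf m\in RW(\mathcal X):\mathrm{supp}\,m_x\subset\overline{\mathrm B}_\varepsilon(x)\text{ for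 }\varrho\text{-a.e. }x\}$. $\mathrm{grad}_\varepsilon[u](x,y)=\frac{u(y)-u(x)}{\varepsilon}$. For Borel $A\subset\mathcal X$, $$\mathrm{div}_\varepsilon^{\varrho_i}[\mathbf m](A)=\frac1\varepsilon\Big(\int_A m_x(\mathcal X)\,\mathrm d\varrho_i(x)-\int_{\mathcal X}m_x(A)\,\mathrm d\varrho_i(x)\Big),$$ and for $\underline{\mathbf m}=(\mathbf m^0,\mathbf m^1)$, $\mathrm{div}_\varepsilon^{\boldsymbol\varrho}[\underline{\mathbf m}]:=\mathrm{div}_\varepsilon^{\varrho_0}[\mathbf m^0]-\mathrm{div}_\varepsilon^{\varrho_1}[\mathbf m^1]$. *)

(* Defs.v *)
From HB Require Import structures.
From mathcomp Require Import all_boot all_order all_algebra.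
From mathcomp Require Import all_classical all_reals all_analysis.

Set Implicit Arguments.
Unset Strict Implicit.
Unset Printing Implicit Defensive.

Import Order.TTheory GRing.Theory Num.Theory.
Import numFieldNormedType.Exports.

Local Open Scope classical_set_scope.
Local Open Scope ring_scope.
Local Open Scope ereal_scope.

(* MathComp-Analysis' measurable types are pointed. A space carrying a
   probability measure is nonempty, and the chosen point is never used. *)
#[short(type="pmetricType")]
HB.structure Definition PointedMetric (K : numDomainType) :=
  { M of Metric K M & Pointed M }.

Notation borel X := (g_sigma_algebraType (@open X)).

Section maximum.
Context {d : Order.disp_t} {T : porderType d}.
Implicit Type A : set T.

Definition is_maximum A (m : T) := A m /\ ubound A m.
Definition is_minimum A (m : T) := A m /\ lbound A m.

End maximum.

(* 0 if there is no maximum (resp. minimum) *)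
Definition set_max {R : realType} (A : set R) : R := xget 0%R (is_maximum A).
Definition set_min {R : realType} (A : set R) : R := xget 0%R (is_minimum A).

Section metric.
Context {R : realType}.
Implicit Type X : pmetricType R.

(* not the library's closed_ball, which is the closure of the open ball *)
Definition cball X (x : X) (r : R) : set X := [set y | (mdist x y <= r)%R].

Definition proper_space X : Prop :=
  forall A : set X, closed A -> (exists x r, A `<=` cball x r) -> compact A.

Definition shrinking X (eps : R) : Prop :=
  forall (x : X) (r : R), (0 < r < eps)%R ->
  exists T : borel X -> borel X,
    measurable_fun (cball x eps : set (borel X)) T /\
    forall y, cball x eps y ->
      cball x (eps - r)%R (T y) /\ (mdist (T y : X) (y : X) <= r)%R.

Definition Cb X : set (X -> R) :=
  [set u | continuous u /\ bounded_fun u].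

Definition msupport X (mu : set (borel X) -> \bar R) : set X :=
  [set y | forall U : set X, open U -> U y -> 0 < mu U].

End metric.
Arguments Cb {R} X _.

Section charge_integral.
Context d (T : measurableType d) (R : realType).

(* The library has no integral with respect to a charge. It is defined through
   the Jordan decomposition, which does not depend on the Hahn decomposition
   picked by cid. *)
Definition charge_integral (nu : {charge set T -> \bar R}) (f : T -> \bar R) :=
  let: exist P exN := cid (Hahn_decomposition nu) in
  let: exist N nuPN := cid exN in
  \int[jordan_pos nuPN]_x f x - \int[jordan_neg nuPN]_x f x.

End charge_integral.

(* The label set {0, 1} is bool, with false for 0 and true for 1. *)
Section marginal.
Context d (T : measurableType d) (R : realType).
Variables (mu : probability (T * bool)%type R) (i : bool).

Definition marginal (A : set T) : \bar R := mu (A `*` [set i]).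

Let marginal0 : marginal set0 = 0.
Proof. by rewrite /marginal set0X measure0. Qed.

Let marginal_ge0 A : 0 <= marginal A.
Proof. exact: measure_ge0. Qed.

Let mX A : measurable A ->
  measurable (A `*` [set i] : set (T * bool)%type).
Proof. by move=> mA; exact: measurableX. Qed.

Let marginal_sigma_additive : semi_sigma_additive marginal.
Proof.
move=> F mF tF mUF; rewrite /marginal.
have -> : (\bigcup_n F n) `*` [set i] = \bigcup_n (F n `*` [set i]).
  by apply/seteqP; split=> [[x j] /= [[n _ Fnx] ->]|[x j] [n _ [/= Fnx ->]]];
     [exists n|split => //; exists n].
apply: measure_semi_sigma_additive => [n||].
- exact: mX.
- apply/trivIsetP => m n _ _ mn.
  move/trivIsetP : tF => /(_ m n Logic.I Logic.I mn) mn0.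
  by rewrite -setXI mn0 set0X.
- by apply: bigcup_measurable => n _; exact: mX.
Qed.

HB.instance Definition _ := isMeasure.Build _ _ _ marginal
  marginal0 marginal_ge0 marginal_sigma_additive.

Let marginal_fin : fin_num_fun marginal.
Proof. by move=> A mA; rewrite /marginal fin_num_measure//; exact: mX. Qed.

HB.instance Definition _ := Measure_isFinite.Build _ _ _ marginal marginal_fin.

End marginal.

Section divergence.
Context d (T : measurableType d) (R : realType).
Variables (eps : R) (rho : {finite_measure set T -> \bar R})
  (m : R.-pker T ~> T).

Definition kmean (A : set T) : \bar R := \int[rho]_x m x A.

Let kmean0 : kmean set0 = 0.
Proof. by rewrite /kmean; under eq_integral do rewrite measure0; exact: integral0. Qed.

Let kmean_ge0 A : 0 <= kmean A. Proof. exact: integral_ge0. Qed.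

Let kmean_sigma_additive : semi_sigma_additive kmean.
Proof.
move=> F mF tF mUF.
rewrite [X in _ --> X](_ : _ = \int[rho]_x (\sum_(n <oo) m x (F n))); last first.
  apply: eq_integral => x _.
  by apply/esym/cvg_lim => //; exact/measure_semi_sigma_additive.
apply/cvg_closeP; split.
  by apply: is_cvg_nneseries => n _ _; exact: integral_ge0.
rewrite closeE// integral_nneseries// => n; exact: measurable_kernel.
Qed.

HB.instance Definition _ := isMeasure.Build _ _ _ kmean
  kmean0 kmean_ge0 kmean_sigma_additive.

Let kmean_fin : fin_num_fun kmean.
Proof.
apply: lty_fin_num_fun => /=; suff -> : kmean setT = rho setT.
  by rewrite ltey_eq fin_num_measure.
rewrite [LHS](eq_integral (cst 1)); first by rewrite integral_cst// mul1e.
by move=> x _; rewrite prob_kernel.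
Qed.

HB.instance Definition _ := Measure_isFinite.Build _ _ _ kmean kmean_fin.

Definition div (A : set T) : \bar R :=
  (eps^-1)%:E * (\int[rho]_(x in A) m x [set: T] - \int[rho]_x m x A).

Let aux : {charge set T -> \bar R} := cscale eps^-1
  (cadd (charge_of_finite_measure rho) (copp (charge_of_finite_measure kmean))).

Let divE A : measurable A -> div A = aux A.
Proof.
move=> mA; rewrite /div; congr (_ * (_ - _)).
by under eq_integral do rewrite prob_kernel; rewrite integral_cst// mul1e.
Qed.

Let div0 : div set0 = 0. Proof. by rewrite divE// charge0. Qed.

Let div_fin A : measurable A -> div A \is a fin_num.
Proof. by move=> mA; rewrite divE// fin_num_measure. Qed.

Let div_sigma_additive : semi_sigma_additive div.
Proof.
move=> F mF tF mUF; rewrite divE//.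
under eq_fun do under eq_bigr do rewrite divE//.
exact: charge_semi_sigma_additive.
Qed.

HB.instance Definition _ := isCharge.Build _ _ _ div
  div0 div_fin div_sigma_additive.

End divergence.

Section divergence_pair.
Context d (T : measurableType d) (R : realType).
Variables (eps : R) (mu : probability (T * bool)%type R)
  (m : (R.-pker T ~> T) * (R.-pker T ~> T)).

Definition div_pair (A : set T) : \bar R :=
  div eps (marginal mu false) m.1 A - div eps (marginal mu true) m.2 A.

Let aux : {charge set T -> \bar R} := cadd (div eps (marginal mu false) m.1)
  (copp (div eps (marginal mu true) m.2)).

Let div0 : div_pair set0 = 0. Proof. exact: (@charge0 _ _ _ aux). Qed.

Let div_fin A : measurable A -> div_pair A \is a fin_num.
Proof. exact: (@fin_num_measure _ _ _ aux). Qed.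

Let div_sigma_additive : semi_sigma_additive div_pair.
Proof. exact: (@charge_semi_sigma_additive _ _ _ aux). Qed.

HB.instance Definition _ := isCharge.Build _ _ _ div_pair
  div0 div_fin div_sigma_additive.

End divergence_pair.

Section nonlocal.
Context {R : realType} {X : pmetricType R}.
Variables (eps : R) (mu : probability (borel X * bool)%type R).

Definition grad (u : X -> R) (x y : X) : R := ((u y - u x) / eps)%R.

Definition TV (u : X -> R) : \bar R :=
  \int[marginal mu false]_x (((set_max (u @` cball x eps) - u x) / eps)%R)%:E +
  \int[marginal mu true]_x (((u x - set_min (u @` cball x eps)) / eps)%R)%:E.

(* The probability kernels R.-pker are the families of Borel probability
   measures such that x |-> m x A is Borel for every Borel set A. *)
Definition random_walk : set (R.-pker borel X ~> borel X) :=
  [set m : R.-pker borel X ~> borel X |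
    exists x0 : X, forall x, \int[m x]_y (mdist x0 (y : X))%:E < +oo].

Definition admissible : set (R.-pker borel X ~> borel X) :=
  random_walk `&`
  [set m : R.-pker borel X ~> borel X | {ae measure_add (marginal mu false) (marginal mu true),
             forall x, msupport (m x) `<=` cball (x : X) eps}].

End nonlocal.

(* Main.v *)
Require Import Defs.
From HB Require Import structures.
From mathcomp Require Import all_boot all_order all_algebra.
From mathcomp Require Import all_classical all_reals all_analysis.
From mathcomp Require Import measurable_realfun ring lra.
Import Order.TTheory GRing.Theory Num.Theory.
Import numFieldNormedType.Exports.
Local Open Scope classical_set_scope.
Local Open Scope ring_scope.
Local Open Scope ereal_scope.

(** The integral of u against the divergence unfolds, through the Jordan
decomposition, to the double integral of the gradient.  For the variational
formula, an admissible m_x lives on the closed ball of radius eps around x, so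
replacing it by a Dirac mass at a maximiser of u on that ball can only increase
the integral of u; this bounds the functional by TV.  Equality holds once the
maximiser is chosen measurably in x.  Balls being compact, such a choice is
made by successive minimisation: first -u, then the distances to the points of
a dense sequence, which leaves exactly one point.  Measurability in x survives
each step in the form: the set of x whose candidate set meets a given closed
set is measurable. *)

(** * Integration against a charge given as a multiple of a difference of measures *)

Lemma integral_mscale d (T : measurableType d) (R : realType)
    (m : {measure set T -> \bar R}) (k : {nonneg R}) (f : T -> \bar R) :
  m.-integrable setT f ->
  \int[mscale k m]_x f x = k%:num%:E * \int[m]_x f x.
Proof.
move=> intf; have mf := measurable_int _ intf.
rewrite [LHS]integralE ge0_integral_mscale//; last exact: measurable_funepos.
rewrite ge0_integral_mscale//; last exact: measurable_funeneg.
by rewrite -muleBr 1?[in RHS]integralE// integrable_add_def.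
Qed.

Lemma bounded_integrable d (T : measurableType d) (R : realType)
    (a : {measure set T -> \bar R}) (f : T -> R) :
  a setT < +oo -> measurable_fun setT f -> bounded_fun f ->
  a.-integrable setT (EFin \o f).
Proof. by move=> aT mf bf; exact: measurable_bounded_integrable. Qed.

(** Whatever Hahn decomposition was chosen, comparing its Jordan parts with [a] and [b] yields two
    equal sums of finite measures. Integrating [f] against both and rearranging finite terms
    suffices, so no Jordan part is ever computed. *)
Lemma charge_integralE d (T : measurableType d) (R : realType)
    (nu : {charge set T -> \bar R}) (c : {nonneg R})
    (a b : {measure set T -> \bar R}) (f : T -> R) :
  a setT < +oo -> b setT < +oo ->
  (forall A, measurable A -> nu A = c%:num%:E * (a A - b A)) ->
  measurable_fun setT f -> bounded_fun f ->
  charge_integral nu (EFin \o f) =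
  c%:num%:E * (\int[a]_x (f x)%:E - \int[b]_x (f x)%:E).
Proof.
move=> aoo boo nuE mf bf.
rewrite /charge_integral; case: cid => P exN; case: cid => N nuPN.
set p := jordan_pos nuPN; set n := jordan_neg nuPN.
have poo : p setT < +oo by rewrite ltey_eq fin_num_measure.
have noo : n setT < +oo by rewrite ltey_eq fin_num_measure.
have fin (m : {measure set T -> \bar R}) A : m setT < +oo -> measurable A ->
    m A \is a fin_num.
  move=> moo mA; rewrite ge0_fin_numE// (le_lt_trans _ moo)//.
  by rewrite le_measure// inE.
have scoo (m : {measure set T -> \bar R}) : m setT < +oo ->
    mscale c m setT < +oo.
  by move=> moo; rewrite /mscale/= lte_mul_pinfty// lee_fin.
(* From p - n = c (a - b), rearranged so that both sides are measures. *)
have pbna A : measurable A ->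
    measure_add p (mscale c b) A = measure_add n (mscale c a) A.
  move=> mA; rewrite /measure_add /msum/= !big_ord_recl !big_ord0/= !adde0.
  have := nuE _ mA; rewrite (jordan_decomp nuPN mA) /cadd/= cscaleN1/=.
  rewrite -/p -/n /mscale/=.
  move: (fin _ _ poo mA) (fin _ _ noo mA) (fin _ _ aoo mA) (fin _ _ boo mA).
  case: (p A) (n A) (a A) (b A) => [x| |] [y| |] [z| |] [t| |]//= _ _ _ _.
  by move=> [h]; congr EFin; lra.
have iE : \int[measure_add p (mscale c b)]_x (f x)%:E =
    \int[measure_add n (mscale c a)]_x (f x)%:E.
  by apply: eq_measure_integral => A mA _; exact: pbna.
have int m moo := @bounded_integrable _ _ _ m f moo mf bf.
move: iE; rewrite !integral_measure_add//; do ?by apply: int => //; exact: scoo.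
rewrite !integral_mscale//; do ?by apply: int.
have finI (m : {measure set T -> \bar R}) : m setT < +oo ->
    \int[m]_x (f x)%:E \is a fin_num.
  by move=> moo; apply: integrable_fin_num => //; exact: int.
move: (finI _ poo) (finI _ noo) (finI _ aoo) (finI _ boo).
rewrite /comp/=.
case: (integral p _ _) (integral n _ _) (integral a _ _) (integral b _ _)
  => [x| |] [y| |] [z| |] [t| |]//= _ _ _ _.
by move=> [h]; congr EFin; lra.
Qed.

(** * Integration against [kmean], the mean of a kernel *)

Section constant_kernel.
Context d (T : measurableType d) (R : realType)
  (rho : {finite_measure set T -> \bar R}).

(* Makes kmean a composition of kernels, so that integral_kcomp applies. *)
Definition kcst (_ : unit) : {measure set T -> \bar R} := rho.

Let measurable_kcst U : measurable U -> measurable_fun [set: unit] (kcst ^~ U).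
Proof. by move=> _; exact: measurable_cst. Qed.

HB.instance Definition _ := isKernel.Build _ _ _ _ R kcst measurable_kcst.

Let kcst_uub : measure_fam_uub kcst.
Proof.
exists (fine (rho setT) + 1)%R => t.
by rewrite /kcst -[ltLHS]fineK ?fin_num_measure// lte_fin ltrDl.
Qed.

HB.instance Definition _ := Kernel_isFinite.Build _ _ _ _ R kcst kcst_uub.

End constant_kernel.

Lemma ge0_integral_kmean d (T : measurableType d) (R : realType)
    (rho : {finite_measure set T -> \bar R}) (m : R.-pker T ~> T)
    (f : T -> \bar R) :
  (forall x, 0 <= f x) -> measurable_fun setT f ->
  \int[kmean rho m]_y f y = \int[rho]_x \int[m x]_y f y.
Proof.
(* The second kernel of a composition also sees the input of the first; [kernel_snd] makes [m]
   ignore that unit component. *)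
move=> f0 mf; rewrite -(@integral_kcomp _ _ _ _ _ _ _ (kcst _ _ _ rho)
  (kernel.kernel_snd m) tt)//.
Qed.

Section kernel_integral.
Context d (T : measurableType d) (R : realType).
Variables (rho : {finite_measure set T -> \bar R}) (m : R.-pker T ~> T).

(** Unit mass of [m x] keeps the inner integral within [M], and constants are integrable for the
    finite measure [rho]. Measurability in [x] is obtained for the two nonnegative parts of [f]
    separately. *)
Lemma kernel_integral_integrable (f : T -> \bar R) (M : R) :
  measurable_fun setT f -> (forall x, `|f x| <= M%:E) ->
  rho.-integrable setT (fun x => \int[m x]_y f y).
Proof.
move=> mf fM.
have mker (g : T -> \bar R) : (forall x, 0 <= g x) -> measurable_fun setT g ->
    measurable_fun setT (fun x => \int[m x]_y g y).
  by move=> g0 mg; apply: measurable_fun_integral_kernel => // U mU;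
    exact: measurable_kernel.
have M0 : 0 <= M%:E by rewrite (le_trans _ (fM point)).
apply: (@le_integrable _ _ _ _ _ _ _ (cst M%:E)) => //.
- under eq_fun do rewrite integralE.
  by apply: emeasurable_funB; apply: mker => //;
    [exact: measurable_funepos|exact: measurable_funeneg].
- move=> x _; rewrite [leRHS]gee0_abs//.
  rewrite (le_trans (le_abse_integral _ _ mf))//.
  rewrite (le_trans (@integral_le_bound _ _ _ (m x) setT _ M%:E _ _ _ _))//.
  + exact: aeW.
  + by rewrite [X in _ * X]prob_kernel mule1.
- apply/integrableP; split => //.
  rewrite integral_cst//= lte_mul_pinfty//.
  by rewrite ltey_eq fin_num_measure.
Qed.

Lemma integral_kmean (f : T -> \bar R) (M : R) :
  measurable_fun setT f -> (forall x, `|f x| <= M%:E) ->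
  \int[kmean rho m]_y f y = \int[rho]_x \int[m x]_y f y.
Proof.
move=> mf fM.
have mfp : measurable_fun setT f^\+ by exact: measurable_funepos.
have mfn : measurable_fun setT f^\- by exact: measurable_funeneg.
rewrite integralE !ge0_integral_kmean//.
rewrite -integralB//.
- by apply: eq_integral => x _; rewrite [RHS]integralE.
- apply: (@kernel_integral_integrable _ M) => // x.
  by rewrite (le_trans _ (fM x))// gee0_abs// -/((abse \o f) x) fune_abse leeDl.
- apply: (@kernel_integral_integrable _ M) => // x.
  by rewrite (le_trans _ (fM x))// gee0_abs// -/((abse \o f) x) fune_abse leeDr.
Qed.

End kernel_integral.

(** Merges a difference of two divergences into one scaled difference, the shape that
    [charge_integralE] accepts. *)
Lemma mule_subeACA (R : realDomainType) (c : R) (x y z t : \bar R) :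
  x \is a fin_num -> y \is a fin_num -> z \is a fin_num ->
  t \is a fin_num ->
  c%:E * (x - z) - c%:E * (y - t) = c%:E * ((x + t) - (z + y)).
Proof.
case: x y z t => [x| |] [y| |] [z| |] [t| |]//= _ _ _ _.
by congr EFin; ring.
Qed.

Lemma oppe_muleB (R : realDomainType) (c : R) (x y : \bar R) :
  x \is a fin_num -> y \is a fin_num ->
  - (c%:E * (x - y)) = c%:E * (y - x).
Proof. by case: x y => [x| |] [y| |]//= _ _; congr EFin; ring. Qed.

Lemma div_kmeanE d (T : measurableType d) (R : realType) (eps : R)
    (rho : {finite_measure set T -> \bar R}) (m : R.-pker T ~> T) A :
  measurable A -> div eps rho m A = eps^-1%:E * (rho A - kmean rho m A).
Proof.
move=> mA; rewrite /div; congr (_ * (_ - _)).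
by under eq_integral do rewrite prob_kernel; rewrite integral_cst// mul1e.
Qed.

(** * Integration by parts for the nonlocal gradient *)

Section gradient.
Context d (T : measurableType d) (R : realType).
Variables (eps : R) (u : T -> R).
Hypotheses (eps0 : (0 < eps)%R) (mfu : measurable_fun setT u)
  (bu : bounded_fun u).

Let epsV_ge0 : (0 <= eps^-1)%R. Proof. by rewrite invr_ge0 ltW. Qed.

Let epsV : {nonneg R} := NngNum epsV_ge0.

Let mEu : measurable_fun setT (EFin \o u).
Proof. exact/measurable_EFinP. Qed.

Let bound : {M : R | forall x, `|(u x)%:E| <= M%:E}.
Proof.
(* Boundedness only provides bounds strictly above some [M], hence the [+ 1]. *)
apply/cid; have [M [_ /(_ (`|M| + 1)%R)]] := bu.
rewrite (le_lt_trans (ler_norm _)) ?ltrDl// => /(_ isT) uM.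
by exists (`|M| + 1)%R => x; rewrite lee_fin; exact: uM.
Qed.

Let int_u (rho : {finite_measure set T -> \bar R}) :
  rho.-integrable setT (EFin \o u).
Proof. by apply: bounded_integrable; rewrite // ltey_eq fin_num_measure. Qed.

Let int_ku (rho : {finite_measure set T -> \bar R}) (m : R.-pker T ~> T) :
  rho.-integrable setT (fun x => \int[m x]_y (u y)%:E).
Proof. by apply: kernel_integral_integrable mEu (svalP bound). Qed.

Lemma kernel_integral_gradE (m : R.-pker T ~> T) x :
  \int[m x]_y ((u y - u x) / eps)%:E =
  eps^-1%:E * (\int[m x]_y (u y)%:E - (u x)%:E).
Proof.
have iu : (m x).-integrable setT (EFin \o u).
  by apply: bounded_integrable; rewrite // prob_kernel ltry.
have ic : (m x).-integrable setT (cst (u x)%:E).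
  by apply: bounded_integrable => //; rewrite ?prob_kernel ?ltry//;
    exact: bounded_cst.
under eq_integral do rewrite mulrC EFinM EFinB.
rewrite integralZl//; last exact: integrableB.
by rewrite integralB// integral_cst// prob_kernel mule1.
Qed.

Lemma integrable_kernel_grad (rho : {finite_measure set T -> \bar R})
    (m : R.-pker T ~> T) :
  rho.-integrable setT (fun x => \int[m x]_y ((u y - u x) / eps)%:E).
Proof.
under eq_fun do rewrite kernel_integral_gradE.
apply: integrableZl => //.
by apply: integrableB; rewrite //; [exact: int_ku|exact: int_u].
Qed.

Lemma integral_kernel_grad (rho : {finite_measure set T -> \bar R})
    (m : R.-pker T ~> T) :
  \int[rho]_x \int[m x]_y ((u y - u x) / eps)%:E =
  eps^-1%:E * (\int[kmean rho m]_y (u y)%:E - \int[rho]_x (u x)%:E).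
Proof.
under eq_integral do rewrite kernel_integral_gradE.
have iu := int_u rho; have iku := int_ku rho m.
rewrite integralZl//; last exact: integrableB.
rewrite integralB//.
by rewrite (integral_kmean _ _ _ _ _ _ _ mEu (svalP bound)).
Qed.

Lemma charge_integral_div (rho : {finite_measure set T -> \bar R})
    (m : R.-pker T ~> T) :
  \int[rho]_x \int[m x]_y ((u y - u x) / eps)%:E =
  - charge_integral (div eps rho m) (EFin \o u).
Proof.
rewrite integral_kernel_grad.
rewrite (charge_integralE _ _ _ _ epsV rho (kmean rho m))//; first last.
- exact: div_kmeanE.
- by rewrite ltey_eq fin_num_measure.
- by rewrite ltey_eq fin_num_measure.
have finI (r : {finite_measure set T -> \bar R}) :
    \int[r]_x (u x)%:E \is a fin_num by exact: integrable_fin_num (int_u r).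
by rewrite oppe_muleB; first by []; exact: finI.
Qed.

(** Up to the factor [eps^-1], [div_pair] is regrouped as [r0 + k1] minus [k0 + r1];
    [charge_integralE] then applies to it directly, in place of an additivity property of
    [charge_integral]. *)
Lemma charge_integral_div_pair (mu : probability (T * bool)%type R)
    (m : (R.-pker T ~> T) * (R.-pker T ~> T)) :
  - charge_integral (div_pair eps mu m) (EFin \o u) =
  \int[marginal mu false]_x \int[m.1 x]_y ((u y - u x) / eps)%:E -
  \int[marginal mu true]_x \int[m.2 x]_y ((u y - u x) / eps)%:E.
Proof.
set r0 := marginal mu false; set r1 := marginal mu true.
pose k0 := kmean r0 m.1; pose k1 := kmean r1 m.2.
have fin (r : {finite_measure set T -> \bar R}) A : measurable A ->
  r A \is a fin_num by exact: fin_num_measure.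
have addE (r s : {measure set T -> \bar R}) A :
    measure_add r s A = r A + s A.
  by rewrite /measure_add /msum/= !big_ord_recl big_ord0/= adde0.
have addoo (r s : {finite_measure set T -> \bar R}) :
    measure_add r s setT < +oo.
  by rewrite addE lte_add_pinfty// ltey_eq fin_num_measure.
rewrite (charge_integralE _ _ _ _ epsV (measure_add r0 k1)
  (measure_add k0 r1))//; first last.
- move=> A mA; rewrite -/r0 -/r1 -/k0 -/k1.
  transitivity (eps^-1%:E * ((r0 A + k1 A) - (k0 A + r1 A))); last first.
    by rewrite -!addE.
  transitivity (div eps r0 m.1 A - div eps r1 m.2 A); first by [].
  rewrite !div_kmeanE// -/k0 -/k1.
  by apply: mule_subeACA; exact: fin.
- exact: addoo.
- exact: addoo.
rewrite !integral_kernel_grad !integral_measure_add//; try exact: int_u.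
have finI (r : {finite_measure set T -> \bar R}) :
    \int[r]_x (u x)%:E \is a fin_num by exact: integrable_fin_num (int_u r).
rewrite mule_subeACA; do ?exact: finI.
rewrite oppe_muleB; first by rewrite [X in _ * (X - _)]addeC.
- by rewrite fin_numD !finI.
- by rewrite fin_numD !finI.
Qed.

End gradient.

(** * Measurable selection in proper metric spaces *)

Section metric_space.
Context {R : realType} (X : pmetricType R).
Implicit Types (x y : X) (A : set X).

Lemma mdist_continuous x : continuous (mdist x : X -> R).
Proof.
move=> y; apply/cvgrPdist_le => /= e e0.
near=> z.
have yz : (mdist y z <= e)%R.
  by near: z; apply: metricType_numDomainType.cvgr_dist_le e0; exact: cvg_id.
rewrite ler_norml; apply/andP; split.
  rewrite lerBrDl lerBlDr.
  by have := metric_triangle x y z; lra.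
by have := metric_triangle x z y; rewrite (metric_sym z y); lra.
Unshelve. all: by end_near. Qed.

Lemma closed_sublevel (phi : X -> R) (t : R) :
  continuous phi -> closed [set y | (phi y <= t)%R].
Proof.
by move=> cphi; apply: (@closed_comp _ _ phi [set r | (r <= t)%R]) => //;
  exact: closed_le.
Qed.

Lemma cball_closed x (r : R) : closed (cball x r).
Proof. by apply: closed_sublevel; exact: mdist_continuous. Qed.

Lemma mdist_open x (r : R) : open [set y | (mdist x y < r)%R].
Proof.
apply: (@open_comp _ _ (mdist x) [set s | (s < r)%R]) => //.
by move=> y _; exact: mdist_continuous.
Qed.

Lemma open_borel A : open A -> measurable (A : set (borel X)).
Proof. exact: sub_gen_smallest. Qed.

Lemma closed_borel A : closed A -> measurable (A : set (borel X)).
Proof.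
by move=> cA; rewrite -[A]setCK; apply: measurableC; apply: open_borel;
  exact: closed_openC.
Qed.

Lemma continuous_borel (phi : X -> R) :
  continuous phi -> measurable_fun [set: borel X] phi.
Proof.
move=> /continuousP cphi; apply: (measurability _ (RGenOpens.measurableE R)).
move=> _ [_ [a [b ->] <-]]; rewrite setTI; apply: open_borel.
exact/cphi/interval_open.
Qed.

(** Hitting sets are controlled for closed targets, hence this criterion; complements lead back to
    the open generators. *)
Lemma measurable_fun_closed d (T : measurableType d) (f : T -> borel X) :
  (forall K : set X, closed K -> measurable (f @^-1` K)) ->
  measurable_fun [set: T] f.
Proof.
move=> fK; apply: (@measurability _ _ T (borel X) setT f (@open X)) => //.
move=> _ [A oA <-]; rewrite setTI -[A]setCK preimage_setC.
by apply: measurableC; exact: (fK _ (open_closedC oA)).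
Qed.

Lemma cballxx x (r : R) : (0 <= r)%R -> cball x r x.
Proof. by move=> r0; rewrite /cball /= mdistxx. Qed.

Section proper.
Hypothesis properX : proper_space X.

Lemma cball_compact x (r : R) : compact (cball x r).
Proof. by apply: properX; [exact: cball_closed|exists x, r]. Qed.

(** Closed balls of integer radius around [point] are compact and exhaust the space, so each has a
    finite net at every scale [1/(k+1)]; the sequence enumerates all these nets. *)
Lemma proper_dense_seq : exists q : nat -> X,
  forall x (e : R), (0 < e)%R -> exists n, (mdist (q n) x < e)%R.
Proof.
have cov (p : nat * nat) : exists F : seq X,
    forall x, cball (point : X) p.1%:R x ->
      exists2 y, y \in F & (mdist y x < p.2.+1%:R^-1)%R.
  have := @cball_compact point p.1%:R; rewrite compact_cover.
  move=> /(_ X (cball (point : X) p.1%:R)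
    (fun y => [set x | (mdist y x < p.2.+1%:R^-1)%R])) [].
  - by move=> y _; exact: mdist_open.
  - by move=> y py; exists y => //=; rewrite mdistxx.
  by move=> F _ FC; exists (finmap.enum_fset F) => x /FC [y /= yF yx]; exists y.
have /choice[F FP] := cov.
(* [n] codes a radius, a scale and a position in the corresponding net; numbers that code nothing
   are sent to [point]. *)
exists (fun n => if @choice.unpickle ((nat * nat) * nat)%type n
  is Some (p, i) then nth point (F p) i else point) => x e e0.
have [k ke] : exists k : nat, (k.+1%:R^-1 < e)%R.
  by have [k] := ltr_add_invr e0; rewrite add0r; exists k.
pose p := ((Num.truncn (mdist point x)).+1, k).
have [|y yF yx] := FP p x; first by apply: ltW; exact: truncnS_gt.
exists (choice.pickle (p, index y (F p))).
by rewrite choice.pickleK nth_index// (lt_trans yx).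
Qed.

(** * Minimisers over compact sets that vary measurably *)

Definition argmin (phi : X -> R) (A : set X) : set X :=
  [set y | A y /\ forall z, A z -> (phi y <= phi z)%R].

(** The usual measurability of a multifunction, tested on closed sets; for singletons it is
    measurability of the underlying function. *)
Definition measurable_hits d (T : measurableType d) (G : T -> set X) :=
  forall K : set X, closed K -> measurable [set t | G t `&` K !=set0].

Lemma argmin_nonempty phi A : continuous phi -> compact A -> A !=set0 ->
  argmin phi A !=set0.
Proof.
move=> cphi cA A0.
have [|c cA' cmin] := compact_EVT_min A0 cA (f := phi).
  exact: continuous_subspaceT.
by exists c; split=> [|z Az]; [exact: set_mem|apply: cmin; exact: mem_set].
Qed.

Lemma argmin_compact phi A : continuous phi -> compact A ->
  compact (argmin phi A).
Proof.
move=> cphi cA.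
have [->|/set0P[c [Ac cmin]]] := eqVneq (argmin phi A) set0.
  exact: compact0.
suff -> : argmin phi A = A `&` [set y | (phi y <= phi c)%R].
  by apply: compact_closedI => //; exact: closed_sublevel.
apply/seteqP; split=> y [Ay yP]; split => //; first exact: yP.
by move=> z Az; rewrite (le_trans yP)// cmin.
Qed.

(** Whether some minimiser over [G t] lies in [K] is a comparison of two minima, for which countably
    many rational thresholds suffice. All sets tested against [G] are closed. *)
Lemma measurable_hits_argmin d (T : measurableType d) (G : T -> set X) phi :
  continuous phi -> (forall t, compact (G t)) -> measurable_hits d T G ->
  measurable_hits d T (fun t => argmin phi (G t)).
Proof.
move=> cphi cG hG K cK.
pose S (r : R) := [set y | (phi y <= r)%R].
have cS r : closed (S r) by exact: closed_sublevel.
(* Provided G t meets K, some minimiser lies in K iff no rational sublevel set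
   is met by G t but missed by G t `&` K. *)
have -> : [set t | argmin phi (G t) `&` K !=set0] =
    [set t | G t `&` K !=set0] `&` \bigcap_(r : rat)
    (~` [set t | G t `&` S (ratr r) !=set0] `|`
     [set t | G t `&` (K `&` S (ratr r)) !=set0]).
  apply/seteqP; split=> t /=.
    move=> [y [[Gy ymin] Ky]]; split; first by exists y.
    move=> r _; have [GS|] := pselect (G t `&` S (ratr r) !=set0); last by left.
    right; have [z [Gz Sz]] := GS; exists y; split => //; split => //.
    exact: le_trans (ymin _ Gz) Sz.
  move=> [GK GP].
  have [|y [[Gy Ky] ymin]] := argmin_nonempty phi _ cphi _ GK.
    exact: compact_closedI.
  exists y; split => //; split => // z Gz; rewrite leNgt; apply/negP => zy.
  have [r] := rat_in_itvoo zy; rewrite in_itv/= => /andP[zr ry].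
  have [|[w [Gw [Kw Sw]]]] := GP r Logic.I.
    by apply; exists z; split => //; exact: ltW.
  by have := le_lt_trans Sw ry; rewrite ltNge ymin.
apply: measurableI; first exact: hG.
rewrite -[X in measurable X]setCK setC_bigcap; apply: measurableC.
apply: bigcupT_measurable_rat => r; apply: measurableC; apply: measurableU.
  by apply: measurableC; exact: hG.
by apply: hG; exact: closedI.
Qed.

(** Cantor's intersection theorem: a sequence with [y k] in [F k] has a cluster point in [F 0],
    which belongs to every [F n] because compact sets are closed in a Hausdorff space. *)
Lemma bigcap_compact_nonempty (F : nat -> set X) :
  (forall n, compact (F n)) -> (forall n, F n.+1 `<=` F n) ->
  (forall n, F n !=set0) -> \bigcap_n F n !=set0.
Proof.
move=> cF decF F0.
have decFn n k : F (n + k)%N `<=` F n.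
  by elim: k => [|k IH]; rewrite ?addn0// addnS; exact: subset_trans IH.
have /choice[y Fy] := F0.
have yF n : \forall k \near \oo, F n (y k).
  exists n => // k /= nk; apply: (decFn n (k - n)%N).
  by rewrite subnKC.
have [|p [Fp yp]] := cF 0%N (y @ \oo) _; first exact: yF.
exists p => n _; have cFn : closed (F n).
  by apply: compact_closed => //; exact: metric_hausdorff.
by apply: cFn => U Up; apply: yp => //; exact: yF.
Qed.

(** The hitting set is even closed: by properness, a nonempty closed [K] has a point nearest to
    [x]. *)
Lemma measurable_hits_cball (r : R) :
  measurable_hits _ (borel X) (fun x => cball x r).
Proof.
move=> K cK; apply: closed_borel.
rewrite -[X in closed X]setCK; apply: open_closedC.
rewrite openE => x /= xK; apply/nbhs_ballP.
have [K0|K0] := pselect (cball x (r + 1)%R `&` K !=set0); last first.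
  exists 1%R => //= y; rewrite ballEmdist/= => xy [z [yz Kz]].
  apply: K0; exists z; split => //; rewrite /cball/=.
  by have := metric_triangle x y z; move: yz; rewrite /cball/=; lra.
have [|c [[xc Kc] cmin]] :=
  argmin_nonempty (mdist x) _ (mdist_continuous x) _ K0.
  by apply: compact_closedI => //; exact: cball_compact.
have rc : (r < mdist x c)%R.
  by rewrite ltNge; apply/negP => cr; apply: xK; exists c.
(* The bound [1] keeps [z] in the enlarged ball, where [c] is nearest to [x]; the bound
   [mdist x c - r] then puts [z] closer to [x] than [c], a contradiction. *)
exists (Num.min 1 (mdist x c - r))%R => /=.
  by rewrite lt_min ltr01 subr_gt0.
move=> y; rewrite ballEmdist/= lt_min => /andP[xy1 xy] [z [yz Kz]].
have xyz := metric_triangle x y z; rewrite /cball/= in yz.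
have : (mdist x c <= mdist x z)%R.
  by apply: cmin; split => //; rewrite /cball/=; lra.
lra.
Qed.

Fixpoint iter_argmin (q : nat -> X) (A : set X) (n : nat) : set X :=
  if n is k.+1 then argmin (mdist (q k)) (iter_argmin q A k) else A.

(** Minimising successively the distances to a dense sequence shrinks [G t] to one point. Membership
    of that point in [K] is a countable condition on the stages. *)
Lemma measurable_selection d (T : measurableType d) (G : T -> set X) :
  (forall t, compact (G t)) -> (forall t, G t !=set0) ->
  measurable_hits d T G ->
  exists2 f : T -> borel X, measurable_fun [set: T] f & forall t, G t (f t).
Proof.
move=> cG G0 hG; have [q qdense] := proper_dense_seq.
pose H n t := iter_argmin q (G t) n.
have cH n t : compact (H n t).
  by elim: n => //= n IH; apply: argmin_compact => //; exact: mdist_continuous.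
have H0 n t : H n t !=set0.
  elim: n => //= n IH; apply: argmin_nonempty => //.
  - exact: mdist_continuous.
  - exact: cH.
have decH n t : H n.+1 t `<=` H n t by move=> y [].
have hH n : measurable_hits d T (H n).
  elim: n => //= n IH; apply: measurable_hits_argmin => //.
  - exact: mdist_continuous.
  - exact: cH.
have /choice[f Hf] t : \bigcap_n H n t !=set0.
  exact: bigcap_compact_nonempty.
(* Two points of the intersection are equidistant from every [q n], since stage [n.+1] minimises the
   distance to [q n]. A [q n] closer to [y] than half of [mdist y z] contradicts this. *)
have Huniq t y z : (\bigcap_n H n t) y -> (\bigcap_n H n t) z -> y = z.
  move=> Hy Hz; apply/eqP; rewrite -[_ == _]negbK -mdist_gt0; apply/negP => yz.
  have [n qy] := qdense y (mdist y z / 2)%R (divr_gt0 yz (ltr0Sn R 1)).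
  have [[Hny ymin] [Hnz zmin]] := (Hy n.+1 Logic.I, Hz n.+1 Logic.I).
  have := ymin _ Hnz; have := zmin _ Hny.
  have := metric_triangle y (q n) z; rewrite (metric_sym y (q n)); lra.
exists f => [|t]; last exact: (Hf t 0%N).
apply: measurable_fun_closed => K cK.
(* If every stage meets [K], the traces on [K] have a common point by compactness, and by uniqueness
   it is [f t]. *)
have -> : f @^-1` K = \bigcap_n [set t | H n t `&` K !=set0].
  apply/seteqP; split=> t /= => [Kft n _|HK].
    by exists (f t); split => //; exact: Hf.
  have [] := @bigcap_compact_nonempty (fun n => H n t `&` K).
  - by move=> n; exact: compact_closedI.
  - by move=> n; apply: setSI; exact: decH.
  - by move=> n; exact: HK.
  move=> y yP; rewrite (Huniq t (f t) y)//.
  - by have [] := yP 0%N Logic.I.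
  - by move=> n _; have [] := yP n Logic.I.
by apply: bigcapT_measurable => n; exact: hH.
Qed.

Lemma measurable_argmin_cball (phi : X -> R) (r : R) :
  (0 <= r)%R -> continuous phi ->
  exists2 f : borel X -> borel X, measurable_fun [set: borel X] f &
    forall x, argmin phi (cball (x : X) r) (f x).
Proof.
move=> r0 cphi.
apply: (@measurable_selection _ (borel X) (fun x => argmin phi (cball x r))).
- by move=> x; apply: argmin_compact => //; exact: cball_compact.
- move=> x; apply: argmin_nonempty => //; first exact: cball_compact.
  by exists x; exact: cballxx.
- apply: measurable_hits_argmin => //; first by move=> x; exact: cball_compact.
  exact: measurable_hits_cball.
Qed.

(** Each point outside [C] has a null open neighbourhood, hence lies in a null ball centred in the
    dense sequence with radius [1/(k+1)]. There are countably many such balls. *)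
Lemma msupport_negligible (m : {measure set (borel X) -> \bar R}) (C : set X) :
  closed C -> msupport m `<=` C -> m (~` C) = 0.
Proof.
move=> cC mC; have [q qdense] := proper_dense_seq.
pose B (p : nat * nat) : set X := [set y | (mdist (q p.1) y < p.2.+1%:R^-1)%R].
have mB p : measurable (B p : set (borel X)).
  by apply: open_borel; exact: mdist_open.
pose I := [set p | m (B p) = 0].
have CB : ~` C `<=` \bigcup_(p in I) B p.
  move=> y Cy.
  have [U [oU Uy mU0]] : exists U, [/\ open U, U y & m U = 0].
    apply: contrapT => noU; apply: Cy; apply: mC => U oU Uy.
    rewrite lt0e measure_ge0 andbT; apply/eqP => mU0.
    by apply: noU; exists U.
  move: (oU); rewrite openE => /(_ _ Uy) /nbhs_ballP[e /= e0 yU].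
  (* Half of [e], because the ball is centred at [q n] and not at [y]: any two of its points are
     then less than [e] apart. *)
  have [k] := ltr_add_invr (divr_gt0 e0 (ltr0Sn R 1)); rewrite add0r => ke.
  have [n qn] : exists n, (mdist (q n) y < k.+1%:R^-1)%R.
    by apply: qdense; rewrite invr_gt0.
  exists (n, k) => //; rewrite /I/=; apply/eqP.
  rewrite eq_le measure_ge0 andbT -mU0 le_measure ?inE//.
    exact: open_borel.
  move=> z; rewrite /B/= => qz; apply: yU; rewrite ballEmdist/=.
  rewrite (le_lt_trans (metric_triangle y (q n) z))// (metric_sym y).
  by rewrite (splitr e) ltrD// (lt_trans _ ke).
have mI : m.-negligible (\bigcup_(p in I) B p).
  (* Reindexes the balls by natural numbers, with the empty set for numbers that code no pair of
     [I]. *)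
  pose B' n : set (borel X) :=
    if @choice.unpickle (nat * nat)%type n is Some p then
      (if p \in I then B p else set0) else set0.
  have BB' : \bigcup_(p in I) B p `<=` \bigcup_n B' n.
    move=> y [p Ip Bpy]; exists (choice.pickle p) => //.
    by rewrite /B' choice.pickleK mem_set.
  apply: (@negligibleS _ (borel X) _ m _ _ BB'); apply: negligible_bigcup => n.
  rewrite /B'; case: choice.unpickle => [p|]; last exact: negligible_set0.
  case: ifPn => [/set_mem Ip|_]; last exact: negligible_set0.
  by apply/negligibleP => //; exact: mB.
have /negligibleP mCB := @negligibleS _ (borel X) _ m _ _ CB mI.
by rewrite mCB//; apply: open_borel; exact: closed_openC.
Qed.

End proper.
End metric_space.

(** * The variational formula *)

Lemma ae_le_integral d (T : measurableType d) (R : realType)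
    (m : {measure set T -> \bar R}) (f g : T -> \bar R) :
  m.-integrable setT f -> m.-integrable setT g ->
  {ae m, forall x, f x <= g x} -> \int[m]_x f x <= \int[m]_x g x.
Proof.
move=> mf mg [N [mN N0 fgN]].
rewrite (negligible_integral mN)// [leRHS](negligible_integral mN)//.
apply: le_integral => //.
- exact: measurableD.
- by apply: (integrableS measurableT) => //; exact: measurableD.
- by apply: (integrableS measurableT) => //; exact: measurableD.
by move=> x /set_mem[_ Nx]; apply: contrapT => /fgN.
Qed.

(** Brings the support condition of [admissible], stated for the sum of the marginals, to each
    marginal. *)
Lemma ae_measure_add d (T : measurableType d) (R : realType)
    (m1 m2 : {measure set T -> \bar R}) (P : set T) :
  {ae measure_add m1 m2, forall x, P x} ->
  {ae m1, forall x, P x} /\ {ae m2, forall x, P x}.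
Proof.
move=> [N [mN + PN]].
rewrite /measure_add /msum/= !big_ord_recl big_ord0/= adde0 => /eqP.
by rewrite padde_eq0// => /andP[/eqP m1N /eqP m2N]; split; exists N.
Qed.

Lemma set_maxE (R : realType) (A : set R) (m : R) :
  is_maximum A m -> set_max A = m.
Proof.
move=> [Am ubm]; apply: xget_unique => // y [Ay uby].
by apply/eqP; rewrite eq_le ubm// uby.
Qed.

Lemma set_minE (R : realType) (A : set R) (m : R) :
  is_minimum A m -> set_min A = m.
Proof.
move=> [Am lbm]; apply: xget_unique => // y [Ay lby].
by apply/eqP; rewrite eq_le lbm// lby.
Qed.

Section total_variation.
Context {R : realType} (X : pmetricType R).
Variables (eps : R) (mu : probability (borel X * bool)%type R).
Hypotheses (eps_gt0 : (0 < eps)%R) (properX : proper_space X).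
Variable u : X -> R.
Hypothesis Cbu : Cb X u.

Let cu : continuous u. Proof. by case: Cbu. Qed.

Let mfu : measurable_fun [set: borel X] u.
Proof. exact: continuous_borel. Qed.

Let bu : bounded_fun u. Proof. by case: Cbu. Qed.

Let pkdirac (f : borel X -> borel X)
    (mf : measurable_fun [set: borel X] f) :
  R.-pker borel X ~> borel X := kdirac mf.

Let integral_kdirac_grad (f : borel X -> borel X)
    (mf : measurable_fun [set: borel X] f) x :
  \int[kdirac mf x]_y (grad eps u x y)%:E = (grad eps u x (f x))%:E.
Proof.
rewrite integral_dirac// ?diracT ?mul1e//.
apply/measurable_EFinP; apply: measurable_funM => //.
exact: measurable_funB.
Qed.

(** The first moment of a Dirac mass is a single distance. A point outside the ball is not in the
    support, since the complement of the ball is an open neighbourhood of it without mass. *)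
Lemma kdirac_admissible (f : borel X -> borel X)
    (mf : measurable_fun [set: borel X] f) :
  (forall x, cball (x : X) eps (f x)) -> admissible eps mu (kdirac mf).
Proof.
move=> xf; split.
  exists point => x; rewrite integral_dirac//; last first.
    by apply/measurable_EFinP; apply: continuous_borel; exact: mdist_continuous.
  by rewrite diracT mul1e ltry.
apply: aeW => x y ysupp; apply: contrapT => xy.
have := ysupp (~` cball x eps) (closed_openC (cball_closed X x eps)) xy.
rewrite /kdirac/= diracE memNset// ?ltxx//.
by move=> /(_ (xf x)).
Qed.

(** The bounds on [u] hold almost everywhere by [msupport_negligible], and [a] and [b] are their own
    means as [P] has mass 1. *)
Let integral_msupport_bounds (P : {measure set (borel X) -> \bar R})
    (C : set X) (a b : R) :
  P [set: borel X] = 1 -> closed C -> msupport P `<=` C ->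
  (forall y, C y -> (a <= u y <= b)%R) ->
  a%:E <= \int[P]_y (u y)%:E <= b%:E.
Proof.
move=> P1 cC PC uab.
have Poo : P [set: borel X] < +oo by rewrite P1 ltry.
have cstE (c : R) : c%:E = \int[P]_y (cst c%:E) y.
  by rewrite integral_cst// [X in _ * X]P1 mule1.
have ic (c : R) : P.-integrable [set: borel X] (cst c%:E).
  by apply: bounded_integrable => //; exact: bounded_cst.
have iu : P.-integrable [set: borel X] (EFin \o u).
  exact: bounded_integrable.
have PC0 := msupport_negligible X properX P C cC PC.
have mC : measurable (~` C : set (borel X)).
  by apply: open_borel; exact: closed_openC.
rewrite (cstE a) (cstE b); apply/andP; split; apply: ae_le_integral => //.
- exists (~` C); split=> // y /= hy.
  by apply: contra_not hy => /uab /andP[+ _]; rewrite lee_fin.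
- exists (~` C); split=> // y /= hy.
  by apply: contra_not hy => /uab /andP[_]; rewrite lee_fin.
Qed.

(** * Extremal kernels: Dirac masses at measurably chosen maximisers and minimisers *)

Section extremal_selection.
Variables (f g : borel X -> borel X).
Hypotheses (mf : measurable_fun [set: borel X] f)
  (mg : measurable_fun [set: borel X] g).
Hypotheses
  (fP : forall x, argmin X (fun y => - u y)%R (cball (x : X) eps) (f x))
  (gP : forall x, argmin X u (cball (x : X) eps) (g x)).

Let fg_bounds x y : cball x eps y -> (u (g x) <= u y <= u (f x))%R.
Proof. by move=> xy; rewrite (gP x).2//= -lerN2 (fP x).2. Qed.

(** [f x] maximises and [g x] minimises [u] on the ball, so the Dirac integrals of the gradient are
    the integrands of [TV], the second up to sign. This makes [TV] comparable with any pair of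
    admissible kernels, integrand by integrand. *)
Lemma TV_kdiracE : TV eps mu u =
  \int[marginal mu false]_x \int[kdirac mf x]_y (grad eps u x y)%:E -
  \int[marginal mu true]_x \int[kdirac mg x]_y (grad eps u x y)%:E.
Proof.
rewrite /TV; congr (_ + _).
  apply: eq_integral => x _; rewrite integral_kdirac_grad /grad.
  congr (((_ - _) / _)%R%:E).
  apply: set_maxE; split.
    by exists (f x) => //; exact: (fP x).1.
  by move=> _ [y xy <-]; case/andP: (fg_bounds _ _ xy).
rewrite -integralN; last first.
  by apply: integrable_add_def => //; exact: integrable_kernel_grad.
apply: eq_integral => x _.
rewrite integral_kdirac_grad /grad -EFinN -mulNr opprB.
congr (((_ - _) / _)%R%:E); apply: set_minE; split.
  by exists (g x) => //; exact: (gP x).1.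
by move=> _ [y xy <-]; case/andP: (fg_bounds _ _ xy).
Qed.

(** The mean of [u] under [m x] lies between its extreme values on the ball; subtracting [u x] and
    dividing by [eps] preserves the order. *)
Let integral_grad_le (m : R.-pker borel X ~> borel X) x :
  msupport (m x) `<=` cball (x : X) eps ->
  \int[kdirac mg x]_y (grad eps u x y)%:E <= \int[m x]_y (grad eps u x y)%:E
  <= \int[kdirac mf x]_y (grad eps u x y)%:E.
Proof.
move=> mx.
have /andP[mge mle] := integral_msupport_bounds (m x) (cball (x : X) eps) _ _
  (prob_kernel x) (cball_closed X x eps) mx (fg_bounds x).
rewrite /grad !kernel_integral_gradE// !integral_dirac//;
  try exact/measurable_EFinP.
by rewrite !diracT !mul1e; apply/andP; split;
  (apply: lee_wpmul2l; [by rewrite lee_fin invr_ge0 ltW|exact: leeB]).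
Qed.

(** The first integral is bounded above through [f]; the second, which is subtracted, is bounded
    below through [g]. *)
Lemma div_pair_le_TV
    (m : (R.-pker borel X ~> borel X) * (R.-pker borel X ~> borel X)) :
  admissible eps mu m.1 -> admissible eps mu m.2 ->
  - charge_integral (div_pair eps mu m) (EFin \o u) <= TV eps mu u.
Proof.
move=> [_ /ae_measure_add[m1 _]] [_ /ae_measure_add[_ m2]].
rewrite charge_integral_div_pair// TV_kdiracE.
apply: leeB; apply: ae_le_integral; do ?exact: integrable_kernel_grad.
- by apply: filterS m1 => x /(integral_grad_le m.1)/andP[].
- by apply: filterS m2 => x /(integral_grad_le m.2)/andP[].
Qed.

Lemma div_pair_kdirac :
  - charge_integral (div_pair eps mu (pkdirac _ mf, pkdirac _ mg)) (EFin \o u) =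
  TV eps mu u.
Proof. by rewrite charge_integral_div_pair// TV_kdiracE. Qed.

End extremal_selection.

Lemma TV_is_maximum :
  is_maximum
    [set - charge_integral (div_pair eps mu m) (EFin \o u)
       | m in admissible eps mu `*` admissible eps mu]
    (TV eps mu u).
Proof.
have [|f mf fP] := measurable_argmin_cball X properX (fun y => - u y)%R eps
  (ltW eps_gt0).
  by move=> x; apply: cvgN; exact: cu.
have [g mg gP] := measurable_argmin_cball X properX u eps (ltW eps_gt0) cu.
split.
  exists (pkdirac _ mf, pkdirac _ mg); last exact: div_pair_kdirac.
  by split; apply: kdirac_admissible => x; [exact: (fP x).1|exact: (gP x).1].
by move=> _ [m [m1 m2] <-]; exact: (div_pair_le_TV f g mf mg fP gP).
Qed.

End total_variation.

Theorem proposition2p15 (R : realType) (X : pmetricType R) (eps : R)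
    (mu : probability (borel X * bool)%type R)
    (eps_gt0 : (0 < eps)%R)
    (properX : proper_space X)
    (shrinkX : shrinking X eps) :
  (forall (u : X -> R) (m : R.-pker borel X ~> borel X) (i : bool),
     Cb X u -> admissible eps mu m ->
     \int[marginal mu i]_x \int[m x]_y (grad eps u x y)%:E =
     - charge_integral (div eps (marginal mu i) m) (EFin \o u)) /\
  (forall u : X -> R, Cb X u ->
     is_maximum
       [set - charge_integral (div_pair eps mu m) (EFin \o u)
          | m in admissible eps mu `*` admissible eps mu]
       (TV eps mu u)).
Proof.
split=> [u m i Cbu _|u Cbu]; last exact: TV_is_maximum.
rewrite -charge_integral_div//.
- by case: Cbu => cu _; exact: continuous_borel.
- by case: Cbu.
Qed.
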